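(* Let $(\mathbf Z_n,\mathbf A_{n\times n})$ be generated from the stochastic block model with parameters $(\pi,\rho_nS)$, with $\rho_n\to0$ and $n\rho_n\to\infty$ as $n\to\infty$. Then for all $\alpha<\min_a\pi_a$ and all $\delta>0$, \[ |X(\hat{\mathbf z}_n,\mathbf Z_n)-X(\mathbf Z_n,\mathbf Z_n)|<\delta\rho_n \] eventually almost surely as $n\to\infty$, for $\hat{\mathbf z}_n=\hat{\mathbf z}_n^{\mathrm{ML}}$ and $\hat{\mathbf z}_n=\hat{\mathbf z}_n^{\mathrm{ICL}}$ (defined with this $\alpha$). Moreover, $\alpha$ can be taken as a decreasing sequence in $n$, provided $n\rho_n>\frac{4s_{\max}}{\alpha^2\delta^2}$ for $n$ sufficiently large.
   Context: SBM with parameters $(\pi,\rho_nS)$: $k\ge2$ fixed; $\pi$ a probability vector on $[k]$ with all $\pi_a>0$; $S$ a fixed symmetric $k\times k$ matrix with strictly positive entries and no two identical columns, $s_{\max}$ its maximal entry; $P=\rho_nS$. $\mathbf Z_n$ i.i.d. with law $\pi$; given $\mathbf Z_n=\mathbf z_n$, $\mathbf A_{n\times n}$ symmetric, zero diagonal, $A_{ij}$ ($i<j$) independent Bernoulli$(P_{z_iz_j})$. For $\mathbf e_n\in[k]^n$: $n_a(\mathbf e_n)=\#\{i:e_i=a\}$; $n_{ab}=n_an_b$ ($a\ne b$), $n_{aa}=n_a(n_a-1)$; $o_{ab}(\mathbf e_n)=\sum_{i,j}\mathbf 1\{e_i=a,e_j=b\}A_{ij}$; $\tau(x)=x\log x+(1-x)\log(1-x)$.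 $Q_{\mathrm{ML}}(\mathbf e_n)=\frac1{2n^2}\sum_{a,b}n_{ab}\tau(o_{ab}/n_{ab})$; with $\tilde o_{aa}=o_{aa}/2,\tilde n_{aa}=n_{aa}/2$, $\tilde o_{ab}=o_{ab},\tilde n_{ab}=n_{ab}$ ($a\ne b$), $Q_{\mathrm{ICL}}(\mathbf e_n)=\frac1{n^2}\sum_{a\le b}\log\frac{B(\tilde o_{ab}+1/2,\tilde n_{ab}-\tilde o_{ab}+1/2)}{B(1/2,1/2)}$. $\mathcal F(n,\alpha)=\{\mathbf e_n:n_a(\mathbf e_n)\ge\alpha n\ \forall a\}$; $\hat{\mathbf z}_n^{\mathrm{ML}}$, $\hat{\mathbf z}_n^{\mathrm{ICL}}$ maximize $Q_{\mathrm{ML}}$, $Q_{\mathrm{ICL}}$ over $\mathcal F(n,\alpha)$. Confusion matrix $R_{ab}(\mathbf e_n,\mathbf z_n)=\frac1n\sum_i\mathbf 1\{e_i=a,z_i=b\}$; for a nonnegative $k\times k$ matrix $R$, $[P_R]_{ab}=\dfrac{[RPR^T]_{ab}-\delta_{ab}\sum_{i}P_{ii}R_{ai}/n}{[R\mathbf 1]_a([R\mathbf 1]_b-\delta_{ab}/n)}$ ($\delta_{ab}=\mathbf 1\{a=b\}$). Finally $X(\mathbf e_n,\mathbf z_n)=\frac1{2n^2}\sum_{a,b}n_{ab}(\mathbf e_n)\bigl[\tau\bigl(o_{ab}(\mathbf e_n)/n_{ab}(\mathbf e_n)\bigr)-\tau\bigl([P_{R(\mathbf e_n,\mathbf z_n)}]_{ab}\bigr)\bigr]$.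 *)

(* Defs.v *)
From HB Require Import structures.
From mathcomp Require Import all_boot all_order all_algebra.
From mathcomp Require Import all_classical all_reals all_analysis.
Set Implicit Arguments. Unset Strict Implicit. Unset Printing Implicit Defensive.
Import Order.TTheory GRing.Theory Num.Theory.
Local Open Scope ring_scope.

Section SBMDefs.
Variable R : realType.
Variable k : nat.

Definition labeling (n : nat) := {ffun 'I_n -> 'I_k}.
Definition adjacency (n : nat) := {ffun 'I_n * 'I_n -> bool}.

Definition tau (x : R) : R := x * ln x + (1 - x) * ln (1 - x).

Definition Beta (p q : R) : R :=
  Rintegral (@lebesgue_measure R) `]0, 1[%classic
    (fun t => t `^ (p - 1) * (1 - t) `^ (q - 1)).

Definition smax (S : 'I_k -> 'I_k -> R) : R :=
  \big[Num.max/0]_(a < k) \big[Num.max/0]_(b < k) S a b.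

Section Fixed_n.
Variable n : nat.

Definition n_a (e : labeling n) (a : 'I_k) : R := (#|[set i | e i == a]|)%:R.

Definition n_ab (e : labeling n) (a b : 'I_k) : R :=
  if a == b then n_a e a * (n_a e a - 1) else n_a e a * n_a e b.

Definition o_ab (A : adjacency n) (e : labeling n) (a b : 'I_k) : R :=
  \sum_(i < n) \sum_(j < n)
     (if [&& e i == a, e j == b & A (i, j)] then 1 else 0).

Definition Q_ML (A : adjacency n) (e : labeling n) : R :=
  (2 * n%:R ^+ 2)^-1 *
  \sum_(a < k) \sum_(b < k) n_ab e a b * tau (o_ab A e a b / n_ab e a b).

Definition ot_ab (A : adjacency n) (e : labeling n) (a b : 'I_k) : R :=
  if a == b then o_ab A e a b / 2 else o_ab A e a b.
Definition nt_ab (e : labeling n) (a b : 'I_k) : R :=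
  if a == b then n_ab e a b / 2 else n_ab e a b.

Definition Q_ICL (A : adjacency n) (e : labeling n) : R :=
  (n%:R ^+ 2)^-1 *
  \sum_(a < k) \sum_(b < k | (a <= b)%N)
     ln (Beta (ot_ab A e a b + 2^-1) (nt_ab e a b - ot_ab A e a b + 2^-1)
         / Beta 2^-1 2^-1).

Definition Fset (alpha : R) : {set labeling n} :=
  [set e | [forall a, alpha * n%:R <= n_a e a]].

Definition is_maximizer (Q : labeling n -> R) (alpha : R) (e : labeling n) :=
  e \in Fset alpha /\ forall e', e' \in Fset alpha -> Q e' <= Q e.

Definition confusion (e z : labeling n) (a b : 'I_k) : R :=
  (#|[set i | (e i == a) && (z i == b)]|)%:R / n%:R.

Definition P_R (Pm : 'I_k -> 'I_k -> R) (Rm : 'I_k -> 'I_k -> R) (a b : 'I_k) : R :=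
  (\sum_(c < k) \sum_(d < k) Rm a c * Pm c d * Rm b d
     - (a == b)%:R * (\sum_(c < k) Pm c c * Rm a c) / n%:R)
  / ((\sum_(c < k) Rm a c) * ((\sum_(c < k) Rm b c) - (a == b)%:R / n%:R)).

Definition Xstat (Pm : 'I_k -> 'I_k -> R) (A : adjacency n) (e z : labeling n) : R :=
  (2 * n%:R ^+ 2)^-1 *
  \sum_(a < k) \sum_(b < k)
     n_ab e a b * (tau (o_ab A e a b / n_ab e a b)
                   - tau (P_R Pm (confusion e z) a b)).

Definition sbm_pmf (pi : 'I_k -> R) (Pm : 'I_k -> 'I_k -> R)
  (z : labeling n) (A : adjacency n) : R :=
  if [forall i, forall j, A (i, j) == A (j, i)] && [forall i, ~~ A (i, i)] then
    (\prod_(i < n) pi (z i)) *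
    \prod_(i < n) \prod_(j < n | (i < j)%N)
       (if A (i, j) then Pm (z i) (z j) else 1 - Pm (z i) (z j))
  else 0.

End Fixed_n.
End SBMDefs.

Arguments Q_ML {R k n}.
Arguments Q_ICL {R k n}.

(* Main.v *)
Require Import Defs.
From HB Require Import structures.
From mathcomp Require Import all_boot all_order all_algebra.
From mathcomp Require Import all_classical all_reals all_analysis.
From mathcomp Require Import ring lra.
Import Order.TTheory GRing.Theory Num.Theory numFieldNormedType.Exports.
Local Open Scope ring_scope.
Local Open Scope classical_set_scope.

(** The bound holds uniformly over all labelings [e], not only over maximizers in
    [Fset k n alpha].  With [p] the edge probabilities given the true labeling [z],
      2 n^2 (X(e,z) - X(z,z)) = KL(e) - KL(z) + sum_(i != j) c_ij (A_ij - p_ij),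
    where KL(e) >= 0 is the block-weighted relative entropy of the empirical densities
    of [e] with respect to their means, and c_ij is a difference of two logits of
    averages of [p].  All these averages are of order rho, so the divergent term log rho
    cancels in c_ij, which stays bounded.  The linear term then has a Chernoff tail.
    For KL(e), exp(KL(e)/2) is a likelihood ratio maximized over at most
    (n^2+1)^(k^2) block densities, and each ratio has expectation at most 1.  Both tails
    are exp(- kappa n^2 rho), which beats the k^n labelings as n rho -> oo; conclude by
    Borel-Cantelli. *)

Set Implicit Arguments.
Unset Strict Implicit.
Unset Printing Implicit Defensive.

(** * Block sums over ordered pairs of distinct vertices *)

Section PairSums.
Variables (R : realType) (k n : nat).
Implicit Types (e z : labeling k n) (f : 'I_n * 'I_n -> R).

(** Leaving out the diagonal makes the block sum of [1] equal to [n_ab] also when [a = b], so that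
    every quantity in [Xstat] becomes a sum over one index set. *)
Definition block e f (a b : 'I_k) : R :=
  \sum_(x | [&& x.1 != x.2, e x.1 == a & e x.2 == b]) f x.

Lemma sum_block e f (g : 'I_k -> 'I_k -> R) :
  \sum_a \sum_b g a b * block e f a b =
  \sum_(x | x.1 != x.2) g (e x.1) (e x.2) * f x.
Proof.
rewrite (partition_big (fun x => (e x.1, e x.2)) xpredT)//= pair_big/=.
apply: eq_bigr => -[a b] _ /=; rewrite /block mulr_sumr.
apply: eq_big => [x|x]; first by rewrite xpair_eqE.
by case/and3P => _ /eqP -> /eqP ->.
Qed.

Lemma block_sym e f a b : (forall x, f (x.2, x.1) = f x) ->
  block e f a b = block e f b a.
Proof.
move=> fC; rewrite /block (reindex_inj (h := fun x => (x.2, x.1))) /=; last first.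
  by move=> [? ?] [? ?] [-> ->].
apply: eq_big => [x|x _]; last exact: fC.
by rewrite eq_sym [X in _ && X]andbC.
Qed.

Lemma le_block e f g a b :
  (forall x, x.1 != x.2 -> f x <= g x) -> block e f a b <= block e g a b.
Proof. by move=> fg; apply: ler_sum => x /andP[/fg]. Qed.

Lemma blockZ e f c a b : block e (fun x => c * f x) a b = c * block e f a b.
Proof. by rewrite /block mulr_sumr. Qed.

Lemma blockB e f g a b :
  block e (fun x => f x - g x) a b = block e f a b - block e g a b.
Proof. by rewrite /block sumrB. Qed.

Lemma block_full e f a b :
  block e f a b = \sum_(i | e i == a) \sum_(j | e j == b) f (i, j)
    - (a == b)%:R * \sum_(i | e i == a) f (i, i).
Proof.
rewrite /block pair_big_dep/= [X in _ = X - _](bigID (fun x => x.1 != x.2))/=.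
rewrite (eq_bigl (fun x : 'I_n * 'I_n => (e x.1 == a) && (e x.2 == b) && (x.1 != x.2))); last first.
  by move=> x; rewrite andbC.
rewrite -addrA [X in _ = _ + X](_ : _ = 0) ?addr0.
  by apply: eq_bigr => -[].
apply/eqP; rewrite subr_eq0; apply/eqP.
have [<-|ab] := eqVneq a b; last first.
  rewrite mul0r big1// => x /andP[/andP[/eqP xa /eqP xb]]; rewrite negbK => /eqP xx.
  by rewrite -xa -xb xx eqxx in ab.
rewrite mul1r (reindex_onto (fun i : 'I_n => (i, i)) (fun x => x.1))/=; last first.
  by case=> i j /andP[_]; rewrite negbK => /eqP /= ->.
by apply: eq_bigl => i; rewrite !eqxx !andbT andbb.
Qed.

(** Edges are independent only over [i < j], while block sums run over ordered pairs; this is the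
    bridge between the two. *)
Lemma sum_pair_sym f : (forall x, f (x.2, x.1) = f x) ->
  \sum_(x | x.1 != x.2) f x = 2 * \sum_(x : 'I_n * 'I_n | (x.1 < x.2)%N) f x.
Proof.
move=> fC; rewrite (bigID (fun x : 'I_n * 'I_n => (x.1 < x.2)%N))/= mulrDl mul1r.
congr (_ + _).
  by apply: eq_bigl => x; rewrite -val_eqE/=; case: ltngtP.
rewrite (reindex_inj (h := fun x => (x.2, x.1))) /=; last by move=> [? ?] [? ?] [-> ->].
apply: eq_big => [x|x _]; last exact: fC.
by rewrite -val_eqE/=; case: ltngtP.
Qed.

Lemma n_ab_block e a b : n_ab R e a b = block e (fun=> 1) a b.
Proof.
have cardE c (y : R) : \sum_(i | e i == c) y = n_a R e c * y.
  by rewrite sumr_const /n_a cardsE mulr_natl.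
rewrite block_full/= /n_ab !cardE !mulr1.
case: eqP => [->|_]; first by rewrite mul1r mulrBr mulr1.
by rewrite mul0r subr0.
Qed.

Lemma o_ab_block (A : adjacency n) e a b : (forall i, ~~ A (i, i)) ->
  o_ab R A e a b = block e (fun x => (A x)%:R) a b.
Proof.
move=> A0; rewrite block_full/= [X in _ - _ * X]big1 ?mulr0 ?subr0; last first.
  by move=> i _; rewrite (negbTE (A0 i)).
rewrite /o_ab [RHS]big_mkcond; apply: eq_bigr => i _.
case: eqP => //= _; last by apply: big1.
rewrite [RHS]big_mkcond; apply: eq_bigr => j _.
by case: eqP => //= _; case: (A _).
Qed.

(** The [1/n] corrections in [P_R] remove exactly the diagonal pairs, so [P_R] of the confusion
    matrix is the block mean of the edge probabilities. *)
Lemma P_R_block (Pm : 'I_k -> 'I_k -> R) e z a b : (0 < n)%N ->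
  P_R n Pm (confusion R e z) a b =
  block e (fun x => Pm (z x.1) (z x.2)) a b / block e (fun=> 1) a b.
Proof.
move=> n0; have n0' : n%:R != 0 :> R by rewrite pnatr_eq0 -lt0n.
have conf c (g : 'I_k -> R) :
    \sum_(i | e i == c) g (z i) = n%:R * \sum_d confusion R e z c d * g d.
  rewrite (partition_big z xpredT)//= mulr_sumr; apply: eq_bigr => d _.
  rewrite (eq_bigr (fun=> g d)); last by move=> i /andP[_ /eqP ->].
  by rewrite sumr_const /confusion cardsE mulrA mulrCA mulfV ?mulr1 ?mulr_natl.
have conf1 c : n_a R e c = n%:R * \sum_d confusion R e z c d.
  have := conf c (fun=> 1); rewrite sumr_const /n_a cardsE => ->.
  by under eq_bigr do rewrite mulr1.
(* Scaling numerator and denominator by [n^2] turns both into block sums; this is valid even when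
   the denominator vanishes. *)
rewrite -[RHS](_ : (n%:R ^+ 2 * (\sum_c \sum_d confusion R e z a c * Pm c d * confusion R e z b d
    - (a == b)%:R * (\sum_c Pm c c * confusion R e z a c) / n%:R))
  / (n%:R ^+ 2 * ((\sum_c confusion R e z a c) *
      (\sum_c confusion R e z b c - (a == b)%:R / n%:R))) = _).
  by rewrite -mulf_div divff ?expf_neq0// mul1r.
congr (_ / _); last first.
  rewrite -n_ab_block /n_ab !conf1; case: eqP => [<-|_] /=; rewrite ?mulr1n ?mulr0n; field; exact: n0'.
rewrite block_full/= (eq_bigr (fun i => n%:R * \sum_d confusion R e z b d * Pm (z i) d)); last first.
  by move=> i _; rewrite -(conf b (Pm (z i))).
rewrite -mulr_sumr (conf a (fun c => \sum_d confusion R e z b d * Pm c d)).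
rewrite (conf a (fun c => Pm c c)).
rewrite [X in _ * (_ * X) - _](_ : _ =
    \sum_c \sum_d confusion R e z a c * Pm c d * confusion R e z b d); last first.
  by apply: eq_bigr => c _; rewrite mulr_sumr; apply: eq_bigr => d _; ring.
rewrite -(eq_bigr _ (fun c _ => mulrC (Pm c c) (confusion R e z a c))).
by field; exact: n0'.
Qed.

End PairSums.

(** * Gibbs' inequality and the splitting of [Xstat] *)

Lemma gibbs_term (R : realType) (x y : R) : 0 <= x -> 0 < y ->
  x * ln y <= x * ln x + (y - x).
Proof.
rewrite le_eqVlt => /predU1P[<- y0|x0 y0]; first by rewrite !mul0r; lra.
(* This is [ln u <= u - 1] at [u = y / x], to be multiplied by [x]. *)
have := @le_ln1Dx R (y / x - 1); rewrite addrCA subrr addr0 ln_div ?posrE//.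
rewrite ltrBrDl subrr divr_gt0// => /(_ isT) h.
have : x * (ln y - ln x) <= x * (y / x - 1) by rewrite ler_pM2l.
rewrite (_ : x * (y / x - 1) = y - x); last by field; rewrite gt_eqF.
by rewrite mulrBr; lra.
Qed.

(** The linear corrections of [gibbs_term] for the two outcomes, [p - q] and [q - p], cancel. *)
Lemma gibbs (R : realType) (q p : R) : 0 <= q <= 1 -> 0 < p < 1 ->
  q * ln p + (1 - q) * ln (1 - p) <= tau q.
Proof.
move=> /andP[q0 q1] /andP[p0 p1]; rewrite /tau.
have := @gibbs_term R q p q0 p0.
have := @gibbs_term R (1 - q) (1 - p).
by rewrite !subr_ge0 subr_gt0 => /(_ q1 p1); lra.
Qed.

Definition logit (R : realType) (x : R) : R := ln x - ln (1 - x).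

Lemma le_logit (R : realType) (x y : R) : 0 < x -> x <= y -> y < 1 -> logit x <= logit y.
Proof.
move=> x0 xy y1; apply: lerB; first by rewrite ler_ln ?posrE// (lt_le_trans x0).
by rewrite ler_ln ?posrE ?subr_gt0 ?lerB// (le_lt_trans xy).
Qed.

Section Decomposition.
Variables (R : realType) (k n : nat).
Implicit Types (e z : labeling k n) (f p : 'I_n * 'I_n -> R).

Definition avg e f a b : R := block e f a b / block e (fun=> 1) a b.

Lemma avg_sym e f a b : (forall x, f (x.2, x.1) = f x) -> avg e f a b = avg e f b a.
Proof. by move=> fC; rewrite /avg block_sym// [X in _ / X]block_sym. Qed.

Lemma block1_ge0 e a b : 0 <= block e (fun=> 1 : R) a b.
Proof. exact: sumr_ge0. Qed.

Lemma block1_gt0 e (x : 'I_n * 'I_n) : x.1 != x.2 ->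
  0 < block e (fun=> 1 : R) (e x.1) (e x.2).
Proof.
move=> xx; rewrite /block (bigD1 x)/= ?xx ?eqxx//.
by rewrite ltr_pwDl// sumr_ge0.
Qed.

(** This covers empty blocks, where [avg] divides by [0]: the bounds on [f] squeeze its block sum
    between [0] and the size [0]. *)
Lemma block_avg e f a b : (forall x, 0 <= f x <= 1) ->
  block e (fun=> 1) a b * avg e f a b = block e f a b.
Proof.
move=> f01; have [B0|B0] := eqVneq (block e (fun=> 1 : R) a b) 0; last first.
  by rewrite /avg mulrCA mulfV ?mulr1.
rewrite B0 mul0r; apply/eqP; rewrite eq_le; apply/andP; split.
  by apply: sumr_ge0 => x _; case/andP: (f01 x).
by rewrite -B0; apply: le_block => x _; case/andP: (f01 x).
Qed.

Lemma avg_bounds e f a b (lo hi : R) : block e (fun=> 1 : R) a b != 0 ->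
  (forall x, x.1 != x.2 -> lo <= f x <= hi) -> lo <= avg e f a b <= hi.
Proof.
move=> B0 fb; have Bp : 0 < block e (fun=> 1 : R) a b.
  by rewrite lt_neqAle eq_sym B0 block1_ge0.
rewrite /avg ler_pdivlMr// ler_pdivrMr// -!blockZ.
by apply/andP; split; apply: le_block => x /fb/andP[]; rewrite mulr1.
Qed.

(** This is KL(e): each block contributes its size times the relative entropy of two Bernoulli laws,
    with means [avg e f a b] and [avg e p a b]. *)
Definition relent e f p : R := \sum_a \sum_b block e (fun=> 1) a b *
  (tau (avg e f a b) - avg e f a b * ln (avg e p a b)
    - (1 - avg e f a b) * ln (1 - avg e p a b)).

Lemma relent_ge0 e f p (lo hi : R) : (forall x, 0 <= f x <= 1) ->
  0 < lo -> hi < 1 -> (forall x, x.1 != x.2 -> lo <= p x <= hi) ->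
  0 <= relent e f p.
Proof.
move=> f01 lo0 hi1 pb; apply: sumr_ge0 => a _; apply: sumr_ge0 => b _.
have [->|B0] := eqVneq (block e (fun=> 1 : R) a b) 0; first by rewrite mul0r.
rewrite mulr_ge0 ?block1_ge0//.
have /andP[pl ph] := avg_bounds B0 pb.
have := @gibbs R (avg e f a b) (avg e p a b) (avg_bounds B0 (fun x _ => f01 x)).
by rewrite (lt_le_trans lo0 pl) (le_lt_trans ph hi1) => /(_ isT); lra.
Qed.

(** The derivative of [tau] is [logit], and the Bernoulli relative entropy is the Bregman divergence
    of [tau]: [tau q - tau r] equals the entropy of [q] relative to [r] plus [logit r * (q - r)].
    Weighted by block sizes, the second term is a sum over pairs. *)
Lemma Xstat_relent (A : adjacency n) (Pm : 'I_k -> 'I_k -> R) e z :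
  (0 < n)%N -> (forall i, ~~ A (i, i)) ->
  (forall a b, 0 <= Pm a b <= 1) ->
  let f x := (A x)%:R in let p x := Pm (z x.1) (z x.2) in
  2 * n%:R ^+ 2 * Xstat Pm A e z = relent e f p +
   \sum_(x | x.1 != x.2) logit (avg e p (e x.1) (e x.2)) * (f x - p x).
Proof.
move=> n0 A0 Pm01 f p.
have f01 x : 0 <= f x <= 1 by rewrite /f; case: (A x); rewrite lexx ler01.
have p01 x : 0 <= p x <= 1 by exact: Pm01.
rewrite /Xstat mulrA mulfV ?mul1r ?mulf_neq0 ?expf_neq0 ?pnatr_eq0 -?lt0n//.
rewrite -(sum_block e (fun x => f x - p x) (fun a b => logit (avg e p a b))).
rewrite /relent -big_split/=; apply: eq_bigr => a _.
rewrite -big_split/=; apply: eq_bigr => b _.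
rewrite P_R_block// n_ab_block o_ab_block// -/p -/f -!/(avg _ _ _ _).
by rewrite blockB -(block_avg e a b f01) -(block_avg e a b p01) /tau /logit; ring.
Qed.

(** The logarithms are constant on each block, so summing the bits of [A] there gives back size
    times density. The right side is a log likelihood ratio of the empirical block densities against
    the mean ones. *)
Lemma relent_llr (A : adjacency n) e p : let f x := (A x)%:R in
  relent e f p = \sum_(x | x.1 != x.2)
    (if A x then ln (avg e f (e x.1) (e x.2)) - ln (avg e p (e x.1) (e x.2))
     else ln (1 - avg e f (e x.1) (e x.2)) - ln (1 - avg e p (e x.1) (e x.2))).
Proof.
move=> f.
have f01 x : 0 <= f x <= 1 by rewrite /f; case: (A x); rewrite lexx ler01.
pose u a b := ln (avg e f a b) - ln (avg e p a b).
pose v a b := ln (1 - avg e f a b) - ln (1 - avg e p a b).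
transitivity (\sum_(x | x.1 != x.2) (u (e x.1) (e x.2) * f x +
    v (e x.1) (e x.2) * (1 - f x))); last first.
  by apply: eq_bigr => x _; rewrite /f; case: (A x) => /=; rewrite ?subrr ?subr0 ?mulr0 ?mulr1 ?addr0 ?add0r.
rewrite big_split/= -(sum_block e f u) -(sum_block e (fun x => 1 - f x) v).
rewrite -big_split/=; apply: eq_bigr => a _.
rewrite -big_split/=; apply: eq_bigr => b _.
by rewrite blockB -(block_avg e a b f01) /tau /u /v; ring.
Qed.

End Decomposition.

(** * Summation over simple graphs *)

Section SymmetricGraphs.
Variables (R : realType) (n : nat).
Implicit Types (A : adjacency n).

Definition simple A : bool :=
  [forall i, forall j, A (i, j) == A (j, i)] && [forall i, ~~ A (i, i)].

(** A simple graph is a free choice of one bit per pair [i < j], so the sum of products factorizes.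
    This is how independence of the edges enters. *)
Lemma sum_simple (F : 'I_n * 'I_n -> bool -> R) :
  \sum_(A | simple A) \prod_(x : 'I_n * 'I_n | (x.1 < x.2)%N) F x (A x) =
  \prod_(x : 'I_n * 'I_n | (x.1 < x.2)%N) (F x true + F x false).
Proof.
pose up := fun x : 'I_n * 'I_n => (x.1 < x.2)%N.
under [RHS]eq_bigr do rewrite -(big_bool _ (F _)).
rewrite (big_distr_big_dep false up (fun _ => predT)).
(* [h] symmetrizes the upper triangle and [h'] keeps only that triangle; they are mutually inverse
   between bit families supported on [up] and simple graphs. *)
pose h (B : adjacency n) : adjacency n :=
  [ffun x : 'I_n * 'I_n => if (x.1 < x.2)%N then B x else if (x.2 < x.1)%N then B (x.2, x.1) else false].
pose h' (A : adjacency n) : adjacency n := [ffun x => up x && A x].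
rewrite (reindex_onto h h'); last first.
  move=> A /andP[/forallP sA /forallP A0]; apply/ffunP => -[i j]; rewrite !ffunE/= /up/=.
  case: ltngtP => //= ij; first by rewrite (eqP (forallP (sA i) j)).
  by rewrite (val_inj ij) (negbTE (A0 j)).
apply: eq_big => [B|B _]; last by apply: eq_bigr => x xx; rewrite ffunE xx.
have -> : simple (h B).
  apply/andP; split; last by apply/forallP => i; rewrite ffunE/= ltnn.
  by apply/forallP => i; apply/forallP => j; rewrite !ffunE/=; case: ltngtP.
apply/eqP/pfamilyP => [BE|[/supportP Bs _]].
  split=> //; apply/supportP => x; rewrite -topredE/= -BE !ffunE => /negbTE.
  by rewrite /up => ->.
apply/ffunP => x; rewrite !ffunE /up; case: ifP => //= xx.
by rewrite Bs// -topredE/= /up xx.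
Qed.

End SymmetricGraphs.

(** * Union bound and Chernoff bounds for random graphs *)

Lemma le_sum_union (R : numDomainType) (T I : finType) (P : pred T) (Q : I -> pred T) (w : T -> R) :
  (forall x, 0 <= w x) -> (forall x, P x -> exists i, Q i x) ->
  \sum_(x | P x) w x <= \sum_i \sum_(x | Q i x) w x.
Proof.
move=> w0 PQ; under [X in _ <= X]eq_bigr do rewrite big_mkcond.
rewrite exchange_big big_mkcond/=; apply: ler_sum => x _.
have t0 i : 0 <= (if Q i x then w x else 0) by case: ifP.
case: ifP => [/PQ[i Qi]|_]; last exact: sumr_ge0.
by rewrite (bigD1 i)//= Qi lerDl sumr_ge0.
Qed.

(** Inverting [1 - x <= expR (- x)] gives [expR x <= 1 / (1 - x)], and [(1 + x + 2 x^2) (1 - x)]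
    exceeds [1] by [x^2 (1 - 2 x)]. *)
Lemma expR_le_quadratic (R : realType) (x : R) : `|x| <= 2^-1 ->
  expR x <= 1 + x + 2 * x ^+ 2.
Proof.
rewrite ler_norml => /andP[xl xr].
have h := @expR_ge1Dx R (- x); rewrite expRN in h.
have e0 := @expR_gt0 R x.
have x1 : 0 < 1 - x by lra.
have : expR x <= (1 - x)^-1 by rewrite -[expR x]invrK lef_pV2 ?posrE ?invr_gt0.
move=> /le_trans; apply; rewrite -[X in X <= _]mul1r ler_pdivrMr//.
rewrite (_ : _ * (1 - x) = 1 + x ^+ 2 * (1 - 2 * x)); last by ring.
by rewrite lerDl mulr_ge0 ?sqr_ge0//; lra.
Qed.

(** The factor [p] in the exponent is essential for sparse graphs: a Hoeffding bound, without it,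
    would lead to [n^2 rho^2] in place of [n^2 rho]. *)
Lemma bernoulli_mgf (R : realType) (p c : R) : 0 <= p -> `|c| <= 2^-1 ->
  p * expR (c * (1 - p)) + (1 - p) * expR (c * (0 - p)) <= expR (2 * p * c ^+ 2).
Proof.
move=> p0 cb.
have -> : c * (1 - p) = c + - (c * p) by ring.
have -> : c * (0 - p) = - (c * p) by ring.
rewrite expRD mulrA -mulrDl.
have h : p * expR c + (1 - p) <= expR (p * c + 2 * p * c ^+ 2).
  apply: le_trans (expR_ge1Dx _).
  have := ler_wpM2l p0 (expR_le_quadratic cb); rewrite !mulrDr mulr1; lra.
apply: le_trans (ler_wpM2r (expR_ge0 _) h) _.
by rewrite -expRD ler_expR; lra.
Qed.

Section GraphTail.
Variables (R : realType) (k n : nat).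
Implicit Types (A : adjacency n) (e : labeling k n) (c p : 'I_n * 'I_n -> R).

Definition graph_pmf p A : R :=
  \prod_(x : 'I_n * 'I_n | (x.1 < x.2)%N) (if A x then p x else 1 - p x).

Lemma graph_pmf_ge0 p A : (forall x, 0 <= p x <= 1) -> 0 <= graph_pmf p A.
Proof.
move=> p01; apply: prodr_ge0 => x _; case/andP: (p01 x) => p0 p1.
by case: ifP => // _; rewrite subr_ge0.
Qed.

(** Chernoff's method, with the exponential parameter already absorbed in [c]; the number of pairs
    is bounded crudely by [n^2]. *)
Lemma linear_tail p c (hi eta t : R) : 0 <= hi -> (forall x, 0 <= p x <= 1) ->
  (forall x, p x <= hi) -> (forall x : 'I_n * 'I_n, (x.1 < x.2)%N -> `|c x| <= eta) -> eta <= 2^-1 ->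
  \sum_(A | simple A &&
      (t <= \sum_(x : 'I_n * 'I_n | (x.1 < x.2)%N) c x * ((A x)%:R - p x))) graph_pmf p A
    <= expR (2 * hi * eta ^+ 2 * n%:R ^+ 2 - t).
Proof.
move=> hi0 p01 phi ceta eta2.
pose F x (b : bool) := (if b then p x else 1 - p x) * expR (c x * (b%:R - p x)).
have F0 x b : 0 <= F x b.
  by rewrite mulr_ge0 ?expR_ge0//; case/andP: (p01 x) => ? ?; case: b => //; rewrite subr_ge0.
apply: (@le_trans _ _ (expR (- t) * \sum_(A | simple A)
    \prod_(x : 'I_n * 'I_n | (x.1 < x.2)%N) F x (A x))).
  rewrite mulr_sumr big_mkcondr/=; apply: ler_sum => A _.
  rewrite big_split/= -/(graph_pmf p A) -expR_sum mulrCA -expRD.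
  case: ifP => [tA|_]; last by rewrite mulr_ge0 ?expR_ge0 ?graph_pmf_ge0.
  (* On the event the exponent is nonnegative, so the exponential weight is at least [1]. *)
  rewrite ler_peMr ?graph_pmf_ge0//; apply: le_trans (expR_ge1Dx _); lra.
rewrite sum_simple addrC expRD ler_wpM2l ?expR_ge0//.
apply: (@le_trans _ _ (\prod_(x : 'I_n * 'I_n | (x.1 < x.2)%N) expR (2 * hi * eta ^+ 2))).
  apply: ler_prod => x xx; rewrite addr_ge0//= /F /=.
  apply: le_trans (bernoulli_mgf _ (le_trans (ceta x xx) eta2)) _.
    by case/andP: (p01 x).
  rewrite ler_expR -!mulrA ler_pM2l// ler_pM ?sqr_ge0//; first by case/andP: (p01 x).
  by rewrite -real_normK ?num_real// ler_pXn2r ?nnegrE ?(le_trans _ (ceta x xx)) ?ceta.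
rewrite -expR_sum ler_expR sumr_const -[X in X <= _]mulr_natr.
rewrite ler_wpM2l//; first by rewrite (mulr_ge0 _ (sqr_ge0 _))// mulr_ge0.
rewrite -natrX ler_nat (leq_trans (max_card _))// card_prod card_ord.
by rewrite -mulnn.
Qed.

(* The block sums of the factors minus one vanish since [avg e p] is the block mean of [p],
   so [y <= exp (y - 1)] bounds the product by [exp 0]. *)
Lemma likelihood_ratio_sum p e (q : 'I_k -> 'I_k -> R) (lo hi : R) :
  0 < lo -> hi < 1 -> (forall x, lo <= p x <= hi) -> (forall x, p (x.2, x.1) = p x) ->
  (forall a b, 0 <= q a b <= 1) -> (forall a b, q a b = q b a) ->
  \sum_(A | simple A) graph_pmf p A * \prod_(x : 'I_n * 'I_n | (x.1 < x.2)%N)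
    (if A x then q (e x.1) (e x.2) / avg e p (e x.1) (e x.2)
     else (1 - q (e x.1) (e x.2)) / (1 - avg e p (e x.1) (e x.2))) <= 1.
Proof.
move=> lo0 hi1 pb pC q01 qC.
have p01 x : 0 <= p x <= 1 by have /andP[? ?] := pb x; apply/andP; split; lra.
pose u a b := q a b / avg e p a b; pose v a b := (1 - q a b) / (1 - avg e p a b).
pose y x := u (e x.1) (e x.2) * p x + v (e x.1) (e x.2) * (1 - p x).
have -> : \sum_(A | simple A) graph_pmf p A * \prod_(x : 'I_n * 'I_n | (x.1 < x.2)%N)
    (if A x then q (e x.1) (e x.2) / avg e p (e x.1) (e x.2)
     else (1 - q (e x.1) (e x.2)) / (1 - avg e p (e x.1) (e x.2))) =
    \prod_(x : 'I_n * 'I_n | (x.1 < x.2)%N) y x.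
  rewrite -(sum_simple (fun x b => if b then u (e x.1) (e x.2) * p x
    else v (e x.1) (e x.2) * (1 - p x))).
  apply: eq_bigr => A _; rewrite -big_split/=; apply: eq_bigr => x _.
  by case: (A x); rewrite mulrC.
have y0 (x : 'I_n * 'I_n) : (x.1 < x.2)%N -> 0 <= y x.
  move=> xx; have xn : x.1 != x.2 by rewrite -val_eqE/=; case: ltngtP xx.
  have /andP[al ah] := avg_bounds (lt0r_neq0 (block1_gt0 R e xn)) (fun x _ => pb x).
  have /andP[q0 q1] := q01 (e x.1) (e x.2); have /andP[? ?] := p01 x.
  have u0 : 0 <= u (e x.1) (e x.2) by rewrite divr_ge0//; lra.
  have v0 : 0 <= v (e x.1) (e x.2) by rewrite divr_ge0 ?subr_ge0//; lra.
  by rewrite addr_ge0// mulr_ge0// subr_ge0.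
apply: (@le_trans _ _ (\prod_(x : 'I_n * 'I_n | (x.1 < x.2)%N) expR (y x - 1))).
  by apply: ler_prod => x xx; rewrite y0//=; have := expR_ge1Dx (y x - 1); lra.
rewrite -expR_sum.
suff -> : \sum_(x : 'I_n * 'I_n | (x.1 < x.2)%N) (y x - 1) = 0 by rewrite expR0.
have := @sum_pair_sym R n (fun x => y x - 1).
have -> : \sum_(x | x.1 != x.2) (y x - 1) = 0.
  (* The constant is written [1 * 1] to match the shape required by [sum_block]. *)
  transitivity (\sum_(x : 'I_n * 'I_n | x.1 != x.2) ((u (e x.1) (e x.2) * p x +
      v (e x.1) (e x.2) * (1 - p x)) - 1 * 1)).
    by apply: eq_bigr => x _; rewrite mulr1.
  rewrite sumrB big_split/= -(sum_block e p u) -(sum_block e (fun x => 1 - p x) v).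
  rewrite -(sum_block e (fun=> 1) (fun _ _ => 1)) -big_split/= -sumrB big1// => a _.
  rewrite -big_split/= -sumrB big1// => b _.
  rewrite blockB -(block_avg e a b p01) /u /v.
  have [->|B0] := eqVneq (block e (fun=> 1 : R) a b) 0; first by ring.
  have /andP[al ah] := avg_bounds B0 (fun x _ => pb x).
  by field; rewrite !gt_eqF//; lra.
have aC a b : avg e p a b = avg e p b a by exact: avg_sym.
have yC (x : 'I_n * 'I_n) : y (x.2, x.1) - 1 = y x - 1.
  by rewrite /y /u /v pC/= (qC (e x.2)) (aC (e x.2)).
by move=> /(_ yC)/esym/eqP; rewrite mulf_eq0 pnatr_eq0/= => /eqP.
Qed.

End GraphTail.

(** * Tail of the relative entropy *)

Lemma expR_lnB (R : realType) (x y : R) : 0 < x -> 0 < y -> expR (ln x - ln y) = x / y.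
Proof. by move=> x0 y0; rewrite -ln_div ?posrE// lnK// posrE divr_gt0. Qed.

Section EntropyTail.
Variables (R : realType) (k n : nat).
Implicit Types (A : adjacency n) (e z : labeling k n) (c p : 'I_n * 'I_n -> R).

Definition adj A (x : 'I_n * 'I_n) : R := (A x)%:R.

Lemma adj01 A x : 0 <= adj A x <= 1.
Proof. by rewrite /adj; case: (A x); rewrite lexx ler01. Qed.

Lemma adj_sym A x : simple A -> adj A (x.2, x.1) = adj A x.
Proof. by case: x => i j /andP[/forallP/(_ i)/forallP/(_ j)/eqP AE _]; rewrite /adj AE. Qed.

Lemma avg_gt0 e (f : 'I_n * 'I_n -> R) (x : 'I_n * 'I_n) : x.1 != x.2 ->
  (forall y, 0 <= f y) -> 0 < f x -> 0 < avg e f (e x.1) (e x.2).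
Proof.
move=> xx f0 fx; rewrite divr_gt0 ?block1_gt0//.
by rewrite /block (bigD1 x)/= ?xx ?eqxx// ltr_pwDl// sumr_ge0.
Qed.

Lemma avgC e (f : 'I_n * 'I_n -> R) a b : block e (fun=> 1 : R) a b != 0 ->
  avg e (fun x => 1 - f x) a b = 1 - avg e f a b.
Proof. by move=> B0; rewrite /avg blockB mulrBl mulfV. Qed.

(** An edge [x] forces a positive empirical density in its block, and a non-edge forces a density
    below [1], so every logarithm that occurs has a positive argument. Halving passes from ordered
    to unordered pairs. *)
Lemma relent_likelihood A p e (lo hi : R) : simple A ->
  0 < lo -> hi < 1 -> (forall x, lo <= p x <= hi) -> (forall x, p (x.2, x.1) = p x) ->
  expR (relent e (adj A) p / 2) =
  \prod_(x : 'I_n * 'I_n | (x.1 < x.2)%N)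
    (if A x then avg e (adj A) (e x.1) (e x.2) / avg e p (e x.1) (e x.2)
     else (1 - avg e (adj A) (e x.1) (e x.2)) / (1 - avg e p (e x.1) (e x.2))).
Proof.
move=> sA lo0 hi1 pb pC; rewrite relent_llr -/(adj A) sum_pair_sym; last first.
  move=> -[i j] /=; have := adj_sym (i, j) sA; rewrite /adj/= => AE.
  have -> : A (j, i) = A (i, j) by move: AE; do 2!case: (A _) => //=; lra.
  by rewrite !(@avg_sym _ _ _ e _ (e j))// => x; exact: adj_sym.
rewrite mulrAC mulfV ?mul1r ?pnatr_eq0// expR_sum; apply: eq_bigr => x xx.
have xn : x.1 != x.2 by rewrite -val_eqE/=; case: ltngtP xx.
have B0 := lt0r_neq0 (block1_gt0 R e xn).
have /andP[al ah] := avg_bounds B0 (fun x _ => pb x).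
have A01 := adj01 A.
case: ifPn => Ax.
  have h : 0 < avg e (adj A) (e x.1) (e x.2).
    by apply: avg_gt0 => //; rewrite /adj Ax.
  have h2 : 0 < avg e p (e x.1) (e x.2) by lra.
  exact: expR_lnB.
have h : 0 < 1 - avg e (adj A) (e x.1) (e x.2).
  rewrite -avgC//; apply: avg_gt0 => //; first by move=> y; rewrite subr_ge0; case/andP: (A01 y).
  by rewrite /adj (negbTE Ax) subr0.
have h2 : 0 < 1 - avg e p (e x.1) (e x.2) by lra.
exact: expR_lnB.
Qed.

(** The empirical densities depend on [A], whereas [likelihood_ratio_sum] asks for fixed ones.
    Summing over all candidate matrices of edge counts dominates the actual ratio, and Markov's
    inequality gives [expR (- t)] for each candidate. *)
Lemma relent_tail p e (lo hi t : R) :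
  0 < lo -> hi < 1 -> (forall x, lo <= p x <= hi) -> (forall x, p (x.2, x.1) = p x) ->
  \sum_(A | simple A && (2 * t <= relent e (adj A) p)) graph_pmf p A
    <= (((n ^ 2).+1 ^ (k * k))%N)%:R * expR (- t).
Proof.
move=> lo0 hi1 pb pC.
have p01 x : 0 <= p x <= 1 by have /andP[? ?] := pb x; apply/andP; split; lra.
pose V := {ffun 'I_k * 'I_k -> 'I_(n ^ 2).+1}.
pose q (v : V) a b : R := (v (a, b))%:R / block e (fun=> 1) a b.
(* Symmetry and the bound by the block size are what makes [q v] a symmetric matrix with entries in
   [[0, 1]]. *)
pose ok (v : V) := [forall a, forall b, (v (a, b) == v (b, a)) &&
  ((v (a, b))%:R <= block e (fun=> 1 : R) a b)].
pose L (v : V) A := \prod_(x : 'I_n * 'I_n | (x.1 < x.2)%N)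
    (if A x then q v (e x.1) (e x.2) / avg e p (e x.1) (e x.2)
     else (1 - q v (e x.1) (e x.2)) / (1 - avg e p (e x.1) (e x.2))).
have okq v : ok v -> (forall a b, 0 <= q v a b <= 1) /\ (forall a b, q v a b = q v b a).
  move=> /forallP okv; split => a b; have /forallP/(_ b)/andP[/eqP vC vB] := okv a; last first.
    by rewrite /q vC block_sym.
  rewrite /q divr_ge0 ?block1_ge0//=.
  have [->|B0] := eqVneq (block e (fun=> 1 : R) a b) 0; first by rewrite invr0 mulr0 ler01.
  by rewrite ler_pdivrMr ?mul1r// lt_neqAle eq_sym B0 block1_ge0.
have L0 v A : ok v -> 0 <= L v A.
  move=> /okq[q01 _]; apply: prodr_ge0 => x xx.
  have xn : x.1 != x.2 by rewrite -val_eqE/=; case: ltngtP xx.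
  have /andP[al ah] := avg_bounds (lt0r_neq0 (block1_gt0 R e xn)) (fun x _ => pb x).
  have /andP[q0 q1] := q01 (e x.1) (e x.2).
  by case: ifP => _; rewrite divr_ge0 ?subr_ge0//; lra.
have LA A : simple A -> exists2 v, ok v & expR (relent e (adj A) p / 2) = L v A.
  (* The witness is the matrix of actual edge counts of [A], taken over ordered pairs. *)
  move=> sA; pose m a b := (\sum_(x : 'I_n * 'I_n | [&& x.1 != x.2, e x.1 == a & e x.2 == b]) A x)%N.
  have mE a b : (m a b)%:R = block e (adj A) a b by rewrite /m natr_sum.
  have mn a b : (m a b < (n ^ 2).+1)%N.
    rewrite ltnS (@leq_trans (\sum_(x : 'I_n * 'I_n) 1)%N)//; last first.
      by rewrite sum1_card card_prod card_ord mulnn.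
    by rewrite /m big_mkcond leq_sum// => x _; case: ifP => // _; case: (A x).
  pose v : V := [ffun ab => Ordinal (mn ab.1 ab.2)].
  exists v.
    apply/forallP => a; apply/forallP => b; rewrite !ffunE/=; apply/andP; split.
      rewrite -val_eqE/= -(eqr_nat R) !mE; apply/eqP/block_sym => x; exact: adj_sym.
    by rewrite mE; apply: le_block => x _; case/andP: (adj01 A x).
  by rewrite (relent_likelihood e sA lo0 hi1 pb pC); apply: eq_bigr => x _; rewrite /q !ffunE/= !mE.
apply: (@le_trans _ _ (expR (- t) * \sum_(v : V | ok v) \sum_(A | simple A) graph_pmf p A * L v A)).
  rewrite exchange_big/= mulr_sumr big_mkcondr/=; apply: ler_sum => A sA.
  rewrite -mulr_sumr mulrCA.
  have S0 : 0 <= \sum_(v | ok v) L v A by apply: sumr_ge0 => v; exact: L0.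
  case: ifP => [tA|_]; last by rewrite !mulr_ge0 ?expR_ge0 ?graph_pmf_ge0.
  rewrite ler_peMr ?graph_pmf_ge0//.
  have [v okv vE] := LA A sA.
  apply: (@le_trans _ _ (expR (- t) * L v A)).
    by rewrite -vE -expRD; apply: le_trans (expR_ge1Dx _); lra.
  by rewrite ler_wpM2l ?expR_ge0// (bigD1 v)//= lerDl sumr_ge0// => u /andP[/L0].
rewrite mulrC ler_wpM2r ?expR_ge0//.
apply: (@le_trans _ _ (\sum_(v : V | ok v) 1)).
  by apply: ler_sum => v /okq[? ?]; exact: (likelihood_ratio_sum e lo0 hi1 pb pC).
rewrite sumr_const ler_nat (leq_trans (max_card _))//.
by rewrite card_ffun card_prod !card_ord.
Qed.

End EntropyTail.

(** * Tail of [Xstat], uniform over labelings, for fixed [n] *)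

Lemma Xstat_uniform_tail (R : realType) (k n : nat) (Pm : 'I_k -> 'I_k -> R)
    (z : labeling k n) (lo hi s C lam : R) :
  (0 < n)%N -> (forall a b, Pm a b = Pm b a) ->
  0 < lo -> hi < 1 -> (forall a b, lo <= Pm a b <= hi) ->
  logit hi - logit lo <= C -> 0 < lam -> lam * C <= 2^-1 ->
  \sum_(A : adjacency n | simple A &&
      [exists e, s <= `| Xstat Pm A e z - Xstat Pm A z z |])
    graph_pmf (fun x => Pm (z x.1) (z x.2)) A
  <= (k ^ n)%:R * ((((n ^ 2).+1 ^ (k * k))%N)%:R * expR (- (n%:R ^+ 2 * s / 2))
     + 2 * expR (2 * hi * (lam * C) ^+ 2 * n%:R ^+ 2 - lam * (n%:R ^+ 2 * s / 2))).
Proof.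
move=> n0 PmC lo0 hi1 Pmb hC lam0 lamC; set t := n%:R ^+ 2 * s / 2.
pose p (x : 'I_n * 'I_n) := Pm (z x.1) (z x.2).
have pb x : lo <= p x <= hi by exact: Pmb.
have pC x : p (x.2, x.1) = p x by exact: PmC.
have p01 x : 0 <= p x <= 1 by have /andP[? ?] := pb x; apply/andP; split; lra.
have Pm01 a b : 0 <= Pm a b <= 1 by have /andP[? ?] := Pmb a b; apply/andP; split; lra.
have hi0 : 0 <= hi by have /andP[? ?] := Pmb (z (Ordinal n0)) (z (Ordinal n0)); lra.
pose lg (e : labeling k n) (x : 'I_n * 'I_n) := logit (avg e p (e x.1) (e x.2)).
pose c e x := lg e x - lg z x.
have lgb e (x : 'I_n * 'I_n) : x.1 != x.2 -> logit lo <= lg e x <= logit hi.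
  move=> xn; have /andP[al ah] := avg_bounds (lt0r_neq0 (block1_gt0 R e xn)) (fun x _ => pb x).
  by rewrite !le_logit//; lra.
have cb e (x : 'I_n * 'I_n) : (x.1 < x.2)%N -> `|c e x| <= C.
  move=> xx; have xn : x.1 != x.2 by rewrite -val_eqE/=; case: ltngtP xx.
  have /andP[? ?] := lgb e x xn; have /andP[? ?] := lgb z x xn.
  by rewrite ler_norml /c; apply/andP; split; lra.
have lgC e x : lg e (x.2, x.1) = lg e x by rewrite /lg avg_sym.
pose W e (A : adjacency n) := \sum_(x : 'I_n * 'I_n | (x.1 < x.2)%N) c e x * (adj R A x - p x).
have XE e (A : adjacency n) : simple A -> 2 * n%:R ^+ 2 * (Xstat Pm A e z - Xstat Pm A z z) =
    relent e (adj R A) p - relent z (adj R A) p + 2 * W e A.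
  move=> sA; have A0 : forall i, ~~ A (i, i) by case/andP: sA => _ /forallP.
  have XR e' : 2 * n%:R ^+ 2 * Xstat Pm A e' z = relent e' (adj R A) p +
      \sum_(x : 'I_n * 'I_n | x.1 != x.2) lg e' x * (adj R A x - p x).
    exact: Xstat_relent.
  rewrite mulrBr !XR /W -sum_pair_sym; last first.
    by move=> x; rewrite /c !lgC pC (adj_sym _ _ sA).
  rewrite (eq_bigr (fun x => lg e x * (adj R A x - p x) - lg z x * (adj R A x - p x))
    (F1 := fun x => c e x * _)); last first.
    by move=> x _; rewrite /c mulrBl.
  by rewrite sumrB; ring.
(* Three events per labeling: [None] for a large relative entropy, [Some true] and [Some false] for
   the two signs of the linear term. The entropy of [z] is covered by the index [(z, None)]. *)
pose Q (i : labeling k n * option bool) (A : adjacency n) := simple A &&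
  (if i.2 is Some b then lam * t <= \sum_(x : 'I_n * 'I_n | (x.1 < x.2)%N)
      ((if b then lam else - lam) * c i.1 x) * (adj R A x - p x)
   else 2 * t <= relent i.1 (adj R A) p).
apply: (le_trans (le_sum_union (Q := Q) _ _)); first by move=> A; exact: graph_pmf_ge0.
  move=> A /andP[sA /existsP[e]] sX.
  (* The budget [4 t] is split in halves: two nonnegative entropies below [2 t] differ by less than
     [2 t], and [2 * W e A] takes the other [2 t]. *)
  have : 4 * t <= `|2 * n%:R ^+ 2 * (Xstat Pm A e z - Xstat Pm A z z)|.
    have n2 : 0 <= 2 * n%:R ^+ 2 :> R by rewrite mulr_ge0 ?exprn_ge0.
    by rewrite normrM ger0_norm// (_ : 4 * t = 2 * n%:R ^+ 2 * s) ?ler_wpM2l// /t; field.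
  rewrite XE//.
  have := @relent_ge0 R k n e (adj R A) p lo hi (@adj01 _ _ A) lo0 hi1 (fun x _ => pb x).
  have := @relent_ge0 R k n z (adj R A) p lo hi (@adj01 _ _ A) lo0 hi1 (fun x _ => pb x).
  move=> kz ke hX.
  have [h1|h1] := leP (2 * t) (relent e (adj R A) p).
    by exists (e, None); rewrite /Q sA.
  have [h2|h2] := leP (2 * t) (relent z (adj R A) p).
    by exists (z, None); rewrite /Q sA.
  have WE (y : R) : \sum_(x : 'I_n * 'I_n | (x.1 < x.2)%N) (y * c e x) * (adj R A x - p x) = y * W e A.
    by rewrite mulr_sumr; apply: eq_bigr => x _; rewrite mulrA.
  have [h3|h3] := leP t (W e A).
    by exists (e, Some true); rewrite /Q sA /= WE ler_pM2l.
  have [h4|h4] := leP t (- W e A).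
    by exists (e, Some false); rewrite /Q sA /= WE mulNr -mulrN ler_pM2l.
  exfalso; move: hX; rewrite leNgt => /negP; apply.
  by rewrite ltr_norml; apply/andP; split; lra.
have -> : (k ^ n)%:R * ((((n ^ 2).+1 ^ (k * k))%N)%:R * expR (- t)
     + 2 * expR (2 * hi * (lam * C) ^+ 2 * n%:R ^+ 2 - lam * t)) =
  \sum_(i : labeling k n * option bool) (if i.2 is Some b then
     expR (2 * hi * (lam * C) ^+ 2 * n%:R ^+ 2 - lam * t)
     else (((n ^ 2).+1 ^ (k * k))%N)%:R * expR (- t)).
  rewrite -(pair_bigA _ (fun (_ : labeling k n) (o : option bool) => if o is Some b then
     expR (2 * hi * (lam * C) ^+ 2 * n%:R ^+ 2 - lam * t)
     else (((n ^ 2).+1 ^ (k * k))%N)%:R * expR (- t)))/=.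
  rewrite sumr_const card_ffun !card_ord [in LHS]mulr_natl; congr (_ *+ _).
  rewrite (bigD1 None)//=; congr (_ + _).
  rewrite (reindex_onto Some (fun o => odflt true o))/=; last by case.
  by rewrite (eq_bigl xpredT) ?big_bool/=; [ring|move=> b; rewrite eqxx].
apply: ler_sum => -[e [b|]] _ /=; last exact: (relent_tail _ _ lo0 hi1).
apply: (@linear_tail R n p _ hi (lam * C)) => //.
- by move=> x; case/andP: (pb x).
- move=> x xx; rewrite normrM (_ : `|if b then lam else - lam| = lam); last first.
    by case: b; rewrite ?normrN gtr0_norm.
  by rewrite ler_wpM2l ?cb// ltW.
Qed.

(** * Borel-Cantelli, growth comparison and finite unions of atoms *)

Lemma borel_cantelli_geometric (R : realType) (d : measure_display) (T : measurableType d)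
    (P : probability T R) (F : (set T)^nat) (C z : R) (N : nat) :
  (forall n, measurable (F n)) -> 0 <= z < 1 ->
  (forall n, (N <= n)%N -> (P (F n) <= (C * z ^+ n)%:E)%E) ->
  {ae P, forall w, exists N : nat, forall n, (N <= n)%N -> ~ F n w}.
Proof.
move=> mF /andP[z0 z1] PF.
have C0 : 0 <= C * z ^+ N by have := PF N (leqnn _); move/(le_trans (measure_ge0 P _)); rewrite lee_fin.
(* The shift makes the geometric bound hold from index [0] on, so that the whole series can be
   compared. *)
pose G n := F (n + N)%N.
have mG n : measurable (G n) by exact: mF.
have sG : (\sum_(n <oo) P (G n) < +oo)%E.
  apply: (@le_lt_trans _ _ (\sum_(n <oo) (geometric (C * z ^+ N) z n)%:E)%E).
    apply: lee_nneseries => [n _ _|n _]; first exact: measure_ge0.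
    by apply: le_trans (PF _ (leq_addl _ _)) _; rewrite lee_fin /geometric/= -mulrA -exprD addnC.
  rewrite (_ : (\sum_(n <oo) _)%E = (limn (series (geometric (C * z ^+ N) z)))%:E) ?ltry//.
  rewrite -EFin_lim; last by apply: is_cvg_geometric_series; rewrite ger0_norm.
  by apply/congr_lim/funext => n /=; rewrite /series/= sumEFin.
have G0 := lim_sup_set_cvg0 mG sG.
exists (lim_sup_set G); split => //.
  by apply: bigcap_measurable => // n _; apply: bigcup_measurable.
move=> w /= nw n _; apply: contrapT => nG; apply: nw; exists (n + N)%N => m nm Fm.
have Nm : (N <= m)%N by exact: leq_trans (leq_addl n N) nm.
by apply: nG; exists (m - N)%N; rewrite /= ?leq_subRL 1?addnC// /G subnK.
Qed.

(** With [y = n / K] one has [expR n = expR y ^+ K], so it suffices to bound [n^2 + 1 = K^2 y^2 + 1]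
    by a multiple of [expR y], using [y^2 <= 2 expR y]. *)
Lemma polynomial_le_expR (R : realType) (K : nat) : (0 < K)%N ->
  exists2 D : R, 0 <= D & forall n : nat, (((n ^ 2).+1 ^ K)%N)%:R <= D * expR (n%:R).
Proof.
move=> K0; have K0' : 0 < K%:R :> R by rewrite ltr0n.
exists ((2 * K%:R ^+ 2 + 1) ^+ K); first by rewrite exprn_ge0// addr_ge0// mulr_ge0// exprn_ge0.
move=> n; set y : R := n%:R / K%:R.
have y0 : 0 <= y by rewrite divr_ge0.
have -> : expR n%:R = expR y ^+ K.
  by rewrite -expRM_natl /y mulrC mulfVK// gt_eqF.
rewrite natrX -exprMn lerXn2r ?nnegrE ?ler0n//.
rewrite -addn1 natrD natrX (_ : n%:R = K%:R * y); last by rewrite /y mulrC mulfVK// gt_eqF.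
have h2 : y ^+ 2 <= 2 * expR y.
  have := @expR_ge1Dxn R y 1 y0; rewrite (_ : 2`! = 2)%N//; lra.
have h1 := @expR_ge1Dx R y.
have := ler_wpM2l (sqr_ge0 (K%:R : R)) h2.
clearbody y; lra.
Qed.

Lemma measure_le_finsum (R : realType) (d : measure_display) (T : measurableType d)
    (P : probability T R) (I : finType) (Q : pred I) (F : I -> set T) (p : I -> R) :
  (forall i, measurable (F i) /\ P (F i) = (p i)%:E) ->
  let U := \big[setU/set0]_(i | Q i) F i in
  measurable U /\ (P U <= (\sum_(i | Q i) p i)%:E)%E.
Proof.
move=> FP /=; elim/big_rec2: _ => [|i r U _ [mU PU]].
  by rewrite measure0.
have [mF PF] := FP i; split; first exact: measurableU.
by apply: le_trans (measureU2 P mF mU) _; rewrite EFinD -PF; exact: leeD2l.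
Qed.

Section SBM.
Variables (R : realType) (d : measure_display) (T : measurableType d).
Variables (P : probability T R) (k : nat) (pi : 'I_k -> R).

(** [(Z, A)] takes finitely many values, so the event is a finite union of the atoms described by
    the law, which also yields measurability. A bound on the graph mass for each [z] survives
    averaging, as the label weights sum to [1]. *)
Lemma sbm_event_le (n : nat) (Pm : 'I_k -> 'I_k -> R)
    (Z : T -> labeling k n) (A : T -> adjacency n)
    (bad : labeling k n -> adjacency n -> bool) (B : R) :
  (forall a, 0 <= pi a) -> \sum_a pi a = 1 ->
  (forall (z : labeling k n) (a : adjacency n),
      measurable [set w | Z w = z /\ A w = a] /\
      P [set w | Z w = z /\ A w = a] = (sbm_pmf pi Pm z a)%:E) ->
  (forall z, \sum_(a | simple a && bad z a) graph_pmf (fun x => Pm (z x.1) (z x.2)) a <= B) ->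
  measurable [set w | bad (Z w) (A w)] /\ (P [set w | bad (Z w) (A w)] <= B%:E)%E.
Proof.
move=> pi0 pi1 law badB.
have -> : [set w | bad (Z w) (A w)] =
    \big[setU/set0]_(i : labeling k n * adjacency n | bad i.1 i.2) [set w | Z w = i.1 /\ A w = i.2].
  rewrite -bigcup_pred.
  apply/seteqP; split => w /=.
    by move=> bw; exists (Z w, A w).
  by case=> -[z a] /= ? [-> ->].
have [mU PU] := measure_le_finsum (fun i : labeling k n * adjacency n => bad i.1 i.2)
  (fun i => law i.1 i.2).
split=> //; apply: le_trans PU _; rewrite lee_fin.
have pmfE z a : sbm_pmf pi Pm z a = if simple a then
    \prod_(i < n) pi (z i) * graph_pmf (fun x => Pm (z x.1) (z x.2)) a else 0.
  rewrite /sbm_pmf /simple; case: ifP => // _; congr (_ * _).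
  by rewrite pair_big_dep/=; apply: eq_bigr => -[].
have prodpi : \sum_(z : labeling k n) \prod_(i < n) pi (z i) = 1.
  by rewrite -(bigA_distr_bigA (fun (i : 'I_n) a => pi a)) big1.
rewrite -(pair_big_dep xpredT bad (sbm_pmf pi Pm))/= -[B]mul1r -prodpi mulr_suml.
apply: ler_sum => z _.
under eq_bigr do rewrite pmfE; rewrite -big_mkcondr/= -mulr_sumr.
rewrite ler_wpM2l ?prodr_ge0//.
by rewrite (eq_bigl (fun a => simple a && bad z a))// => a; rewrite andbC.
Qed.

End SBM.

(** * Passage to the almost sure statement *)

Lemma positive_kernel_bounds (R : realType) (k : nat) (S : 'I_k -> 'I_k -> R) :
  (0 < k)%N -> (forall a b, 0 < S a b) ->
  exists m M : R, [/\ 0 < m, m <= M & forall a b, m <= S a b <= M].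
Proof.
move=> k0 S0; pose a0 := Ordinal k0.
have leM a b (f : 'I_k -> 'I_k -> R) : (forall a b, 0 < f a b) -> f a b <= \sum_c \sum_e f c e.
  move=> f0; rewrite (bigD1 a)//= (bigD1 b)//= -addrA lerDl addr_ge0//.
    by apply: sumr_ge0 => c _; exact: ltW.
  by do 2!(apply: sumr_ge0 => ? _); exact: ltW.
have V0 a b : 0 < (S a b)^-1 by rewrite invr_gt0.
have Sum0 : 0 < \sum_c \sum_e (S c e)^-1 by apply: lt_le_trans (leM a0 a0 _ V0).
(* Sums stand in for extrema: each entry is at most the sum of all entries, and its inverse at most
   the sum of all inverses. *)
have bnd a b : (\sum_c \sum_e (S c e)^-1)^-1 <= S a b <= \sum_c \sum_e S c e.
  by rewrite leM// andbT -[leRHS]invrK lef_pV2 ?posrE// (leM a b _ V0).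
exists (\sum_c \sum_e (S c e)^-1)^-1, (\sum_c \sum_e S c e); split => //.
  by rewrite invr_gt0.
by have /andP[/le_trans h /h] := bnd a0 a0.
Qed.

(* The bound does not involve [r]: this is where [ln rho] cancels. *)
Lemma logit_gap (R : realType) (m M r : R) : 0 < m -> m <= M -> 0 < r -> r * M <= 2^-1 ->
  logit (r * M) - logit (r * m) <= ln M - ln m + ln 2.
Proof.
move=> m0 mM r0 rM; have M0 : 0 < M by exact: lt_le_trans mM.
have rm : r * m <= r * M by rewrite ler_pM2l.
have rm0 : 0 < r * m by rewrite mulr_gt0.
rewrite /logit !lnM ?posrE//.
have h1 : ln (1 - r * m) <= 0 by rewrite ln_le0; lra.
have h2 : - ln 2 <= ln (1 - r * M) by rewrite -lnV ?posrE// ler_ln ?posrE; lra.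
lra.
Qed.

(** [N] is chosen before [e], so that the bound applies to labelings computed from the data. *)
Lemma Xstat_uniform (R : realType) (d : measure_display) (T : measurableType d)
  (P : probability T R) (k : nat) (pi : 'I_k -> R) (S : 'I_k -> 'I_k -> R)
  (rho : nat -> R)
  (Z : forall n : nat, T -> labeling k n) (A : forall n : nat, T -> adjacency n) (delta : R) :
  (0 < k)%N ->
  (forall a, 0 < pi a) -> \sum_(a < k) pi a = 1 ->
  (forall a b, 0 < S a b) -> (forall a b, S a b = S b a) ->
  rho n @[n --> \oo] --> (0 : R) ->
  n%:R * rho n @[n --> \oo] --> +oo ->
  (forall n (z : labeling k n) (a : adjacency n),
      measurable [set w | Z n w = z /\ A n w = a] /\
      P [set w | Z n w = z /\ A n w = a]
        = (sbm_pmf pi (fun b c => rho n * S b c) z a)%:E) ->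
  0 < delta ->
  {ae P, forall w, exists N : nat, forall n : nat, (N <= n)%N ->
    forall e : labeling k n,
         `| Xstat (fun b c => rho n * S b c) (A n w) e (Z n w)
          - Xstat (fun b c => rho n * S b c) (A n w) (Z n w) (Z n w) |
           < delta * rho n}.
Proof.
move=> k0 pi0 pi1 S0 SC rho0 nrho law d0.
have [m [M [m0 mM Sb]]] := positive_kernel_bounds k0 S0.
have M0 : 0 < M by exact: lt_le_trans mM.
pose C := ln M - ln m + ln 2 + 1.
have C1 : 1 <= C.
  have : ln m <= ln M by rewrite ler_ln ?posrE.
  have : 0 <= ln (2 : R) by rewrite ln_ge0// ler1n.
  by rewrite /C; lra.
pose y := 8 * M * C ^+ 2 / delta.
have y0 : 0 <= y 
  by apply: divr_ge0; [apply: mulr_ge0 (sqr_ge0 _); lra|exact: ltW].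
(* The three summands give [lam * C <= 1/2], [lam * y <= 1] and [lam <= 1]. The second makes the
   quadratic Chernoff term at most half of the linear one. *)
pose lam := (2 * C + y + 1)^-1.
have den0 : 0 < 2 * C + y + 1 by lra.
have lam0 : 0 < lam by rewrite invr_gt0.
have lamE : lam * (2 * C + y + 1) = 1 by rewrite mulVf ?gt_eqF.
have lamy : 0 <= lam * y by exact: mulr_ge0 (ltW lam0) y0.
have lamC0 : 0 < lam * C by rewrite mulr_gt0//; lra.
have lamC : lam * C <= 2^-1 by lra.
have lam1 : lam <= 1 by lra.
have lamd : 8 * M * C ^+ 2 * lam <= delta.
  have -> : 8 * M * C ^+ 2 * lam = delta * (lam * y) by rewrite /y; field; rewrite gt_eqF.
  by rewrite -[leRHS]mulr1 ler_pM2l//; lra.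
(* What remains of the linear rate [lam * delta / 2] after the quadratic term is paid. *)
pose kap := lam * delta / 4.
have kap0 : 0 < kap by rewrite divr_gt0 ?mulr_gt0.
have [D D0 DE] := @polynomial_le_expR R (k * k) (ltac:(by rewrite muln_gt0 k0)).
pose Pm n b c := rho n * S b c.
pose bad n (z : labeling k n) (a : adjacency n) :=
  [exists e, delta * rho n <= `| Xstat (Pm n) a e z - Xstat (Pm n) a z z |].
have pi0' a : 0 <= pi a by exact: ltW.
have mbad n : measurable [set w | bad n (Z n w) (A n w)].
  (* Only measurability is wanted here, and for every [n], including those below the range of the
     tail bound; any finite bound serves. *)
  pose B := \sum_z \sum_(a | simple a && bad n z a) `|graph_pmf (fun x => Pm n (z x.1) (z x.2)) a|.
  have [] // := @sbm_event_le _ _ _ P k pi n (Pm n) (Z n) (A n) (@bad n) B pi0' pi1 (law n).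
  move=> z; apply: le_trans (ler_norm _) (le_trans (ler_norm_sum _ _ _) _).
  by rewrite /B (bigD1 z)//= lerDl; do 2!(apply: sumr_ge0 => ? _).
(* In [k + 2], the part [k] pays for the [k ^ n] labelings, one unit for the polynomial factor, and
   one leaves the summable [expR (-1) ^+ n]. *)
have [N HN] : exists N : nat, forall n, (N <= n)%N ->
    [/\ (0 < n)%N, 0 < rho n, rho n * M <= 2^-1 & k%:R + 2 <= kap * (n%:R * rho n)].
  have h1 : \forall n \near \oo, rho n * M <= 2^-1.
    have /cvgrPdist_le/(_ (2 * M)^-1) := rho0; rewrite invr_gt0 mulr_gt0// => /(_ isT).
    apply: filterS => n; rewrite sub0r normrN => /(le_trans (ler_norm _)) h.
    have -> : 2^-1 = (2 * M)^-1 * M by field; rewrite gt_eqF.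
    by rewrite ler_pM2r.
  have h2 : \forall n \near \oo, (k%:R + 2) / kap <= n%:R * rho n.
    by move/cvgryPge : nrho; exact.
  have [N _ HN] := filterI h1 h2.
  exists N => n /HN[/= r1 r2].
  have r2' : k%:R + 2 <= kap * (n%:R * rho n) by rewrite mulrC -ler_pdivrMr.
  have k0' : 0 < k%:R + 2 :> R by rewrite addr_gt0// ltr0n.
  have nr0 : 0 < n%:R * rho n by rewrite -(pmulr_rgt0 _ kap0) (lt_le_trans k0').
  have n0 : (0 < n)%N by rewrite lt0n; apply: contraTneq nr0 => ->; rewrite mul0r ltxx.
  by split=> //; move: nr0; rewrite pmulr_rgt0// ltr0n.
have Pbad n : (N <= n)%N -> (P [set w | bad n (Z n w) (A n w)] <= ((D + 2) * expR (-1) ^+ n)%:E)%E.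
  move=> /HN[n0 r0 rM kn].
  have [|_] // := @sbm_event_le _ _ _ P k pi n (Pm n) (Z n) (A n) (@bad n)
    ((D + 2) * expR (-1) ^+ n) pi0' pi1 (law n).
  move=> z.
  have lo0 : 0 < rho n * m by rewrite mulr_gt0.
  have hi1 : rho n * M < 1 by lra.
  have PmC a b : Pm n a b = Pm n b a by rewrite /Pm SC.
  have Pmb a b : rho n * m <= Pm n a b <= rho n * M.
    by have /andP[? ?] := Sb a b; rewrite !ler_pM2l//; apply/andP.
  have gap : logit (rho n * M) - logit (rho n * m) <= C.
    by have := logit_gap m0 mM r0 rM; rewrite /C; lra.
  apply: le_trans.
    exact: (@Xstat_uniform_tail R k n (Pm n) z _ _ (delta * rho n) C lam
      n0 PmC lo0 hi1 Pmb gap lam0 lamC).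
  pose E := expR (- (k%:R + 2) * n%:R) : R.
  have X0 : 0 <= n%:R ^+ 2 * rho n by rewrite mulr_ge0 ?sqr_ge0 ?ltW.
  have main : kap * (n%:R ^+ 2 * rho n) >= (k%:R + 2) * n%:R.
    have := ler_wpM2r (ler0n R n) kn; rewrite (_ : kap * _ * n%:R = kap * (n%:R ^+ 2 * rho n))//.
    by ring.
  have kapd : kap <= delta / 2.
    have := ler_wpM2r (ltW d0) lam1; rewrite /kap; lra.
  have E1 : expR (- (n%:R ^+ 2 * (delta * rho n) / 2)) <= E.
    rewrite ler_expR; have := ler_wpM2r X0 kapd; lra.
  have E2 : expR (2 * (rho n * M) * (lam * C) ^+ 2 * n%:R ^+ 2
      - lam * (n%:R ^+ 2 * (delta * rho n) / 2)) <= E.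
    rewrite ler_expR.
    have h : lam * (8 * M * C ^+ 2 * lam) * (n%:R ^+ 2 * rho n) <= lam * delta * (n%:R ^+ 2 * rho n).
      by rewrite ler_wpM2r// ler_pM2l.
    have -> : 2 * (rho n * M) * (lam * C) ^+ 2 * n%:R ^+ 2 - lam * (n%:R ^+ 2 * (delta * rho n) / 2)
      = (lam * (8 * M * C ^+ 2 * lam) * (n%:R ^+ 2 * rho n)) / 4
        - 2 * (kap * (n%:R ^+ 2 * rho n)) by rewrite /kap; field.
    have : lam * delta * (n%:R ^+ 2 * rho n) = 4 * (kap * (n%:R ^+ 2 * rho n)) by rewrite /kap; field.
    lra.
  have En0 : 0 <= expR n%:R :> R by exact: expR_ge0.
  have En1 : 1 <= expR n%:R :> R by apply: le_trans (expR_ge1Dx _); rewrite lerDl.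
  have kE : (k ^ n)%:R <= expR (k%:R * n%:R) :> R.
    rewrite mulrC expRM_natl natrX lerXn2r ?nnegrE ?ler0n ?expR_ge0//.
    by apply: le_trans (expR_ge1Dx _); rewrite lerDr.
  have EE : expR (-1) ^+ n = expR (k%:R * n%:R) * (expR n%:R * E).
    by rewrite /E -!expRD -expRM_natl; congr expR; ring.
  apply: (@le_trans _ _ (expR (k%:R * n%:R) * (D * expR n%:R * E + 2 * E))).
    apply: ler_pM => //.
    apply: lerD; last by rewrite ler_pM2l.
    by apply: ler_pM; rewrite ?expR_ge0.
  rewrite EE mulrCA ler_wpM2l ?expR_ge0//.
  by have := ler_wpM2r (expR_ge0 (- (k%:R + 2) * n%:R) : 0 <= E) En1; lra.
have z1 : 0 <= (expR (-1) : R) < 1 by rewrite expR_ge0 expR_lt1 oppr_lt0 ltr01.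
have := borel_cantelli_geometric mbad z1 Pbad.
apply: filterS => w [N' HN']; exists N' => n /HN' nb e.
by rewrite ltNge; apply/negP => h; apply: nb => /=; apply/existsP; exists e.
Qed.

Unset Implicit Arguments.
Set Strict Implicit.

Theorem theorem5 (R : realType) (d : measure_display) (T : measurableType d)
  (P : probability T R) (k : nat) (pi : 'I_k -> R) (S : 'I_k -> 'I_k -> R)
  (rho : nat -> R)
  (Z : forall n : nat, T -> labeling k n) (A : forall n : nat, T -> adjacency n) :
  (1 < k)%N ->
  (forall a, 0 < pi a) -> \sum_(a < k) pi a = 1 ->
  (forall a b, 0 < S a b) -> (forall a b, S a b = S b a) ->
  (forall a b, a != b -> exists c, S c a != S c b) ->
  (forall n a b, 0 <= rho n * S a b <= 1) ->
  rho n @[n --> \oo] --> (0 : R) ->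
  n%:R * rho n @[n --> \oo] --> +oo ->
  (* for each n, (Z_n, A_n) is distributed as the SBM with parameters (pi, rho_n S) *)
  (forall n (z : labeling k n) (a : adjacency n),
      measurable [set w | Z n w = z /\ A n w = a] /\
      P [set w | Z n w = z /\ A n w = a]
        = (sbm_pmf pi (fun b c => rho n * S b c) z a)%:E) ->
  (* part 1: constant alpha *)
  (forall (alpha delta : R), (forall a, alpha < pi a) -> 0 < delta ->
     forall zhat : forall n : nat, T -> labeling k n,
     ((forall n w, (exists e, e \in Fset k n alpha) ->
         is_maximizer (Q_ML (A n w)) alpha (zhat n w)) ->
      {ae P, forall w, exists N : nat, forall n : nat, (N <= n)%N ->
         `| Xstat (fun b c => rho n * S b c) (A n w) (zhat n w) (Z n w)
          - Xstat (fun b c => rho n * S b c) (A n w) (Z n w) (Z n w) |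
           < delta * rho n}) /\
     ((forall n w, (exists e, e \in Fset k n alpha) ->
         is_maximizer (Q_ICL (A n w)) alpha (zhat n w)) ->
      {ae P, forall w, exists N : nat, forall n : nat, (N <= n)%N ->
         `| Xstat (fun b c => rho n * S b c) (A n w) (zhat n w) (Z n w)
          - Xstat (fun b c => rho n * S b c) (A n w) (Z n w) (Z n w) |
           < delta * rho n})) /\
  (* part 2: alpha a (non-increasing) sequence alpha_n *)
  (forall (alpha : nat -> R) (delta : R),
     (forall n, 0 < alpha n) -> (forall m n, (m <= n)%N -> alpha n <= alpha m) ->
     (forall a, alpha 0%N < pi a) -> 0 < delta ->
     (exists N : nat, forall n : nat, (N <= n)%N ->
        n%:R * rho n > 4 * smax S / (alpha n ^+ 2 * delta ^+ 2)) ->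
     forall zhat : forall n : nat, T -> labeling k n,
     ((forall n w, (exists e, e \in Fset k n (alpha n)) ->
         is_maximizer (Q_ML (A n w)) (alpha n) (zhat n w)) ->
      {ae P, forall w, exists N : nat, forall n : nat, (N <= n)%N ->
         `| Xstat (fun b c => rho n * S b c) (A n w) (zhat n w) (Z n w)
          - Xstat (fun b c => rho n * S b c) (A n w) (Z n w) (Z n w) |
           < delta * rho n}) /\
     ((forall n w, (exists e, e \in Fset k n (alpha n)) ->
         is_maximizer (Q_ICL (A n w)) (alpha n) (zhat n w)) ->
      {ae P, forall w, exists N : nat, forall n : nat, (N <= n)%N ->
         `| Xstat (fun b c => rho n * S b c) (A n w) (zhat n w) (Z n w)
          - Xstat (fun b c => rho n * S b c) (A n w) (Z n w) (Z n w) |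
           < delta * rho n})).

Proof.
move=> k1 pi0 pi1 S0 SC _ _ rho0 nrho law.
(* All four conclusions are instances of the uniform bound at [e = zhat n w]. *)
have X (delta : R) (d0 : 0 < delta) (zhat : forall n : nat, T -> labeling k n) :
    {ae P, forall w, exists N : nat, forall n : nat, (N <= n)%N ->
         `| Xstat (fun b c => rho n * S b c) (A n w) (zhat n w) (Z n w)
          - Xstat (fun b c => rho n * S b c) (A n w) (Z n w) (Z n w) |
           < delta * rho n}.
  have := Xstat_uniform (ltnW k1) pi0 pi1 S0 SC rho0 nrho law d0.
  by apply: filterS => w [N HN]; exists N => n /HN.
by split=> [alpha delta _ d0|alpha delta _ _ _ d0 _] zhat; split=> _; exact: X.
Qed.
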